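(* Let $r\ge 1$, let $\mathbf{k}=(k_1,\dots,k_r)\in\mathbb{Z}^r$, let $p$ be an odd prime, and let $m,n,N$ be positive integers with $m,n\ge N$ and $\operatorname{wt}(\mathbf{k}^+)<p-1$. If $m\equiv n \bmod (p-1)p^{N-1}$, then $$p^{2\operatorname{wt}(\mathbf{k}^+)}B_{m,\star}^{(\mathbf{k})}\equiv p^{2\operatorname{wt}(\mathbf{k}^+)}B_{n,\star}^{(\mathbf{k})} \bmod p^N$$ and $$p^{2\operatorname{wt}(\mathbf{k}^+)}C_{m,\star}^{(\mathbf{k})}\equiv p^{2\operatorname{wt}(\mathbf{k}^+)}C_{n,\star}^{(\mathbf{k})} \bmod p^N.$$
   Context: For $\mathbf{k}=(k_1,\dots,k_r)\in\mathbb{Z}^r$ (an index), put $k_i'=\max\{k_i,0\}$, $\mathbf{k}^+=(k_1',\dots,k_r')$, and $\operatorname{wt}(\mathbf{k})=k_1+\cdots+k_r$, so that $\operatorname{wt}(\mathbf{k}^+)=k_1'+\cdots+k_r'$. The non-strict multiple polylogarithm is the formal power series over $\mathbb{Q}$ $$\operatorname{Li}_{\mathbf{k}}^{\star}(t)=\sum_{0<m_1\le\cdots\le m_r}\frac{t^{m_r}}{m_1^{k_1}\cdots m_r^{k_r}},$$ the sum being over integers $m_1,\dots,m_r$. The multi-poly-Bernoulli-star numbers $B_{n,\star}^{(\mathbf{k})}, C_{n,\star}^{(\mathbf{k})}\in\mathbb{Q}$ ($n\ge 0$) are defined by the identities of formal power series over $\mathbb{Q}$ $$\frac{\operatorname{Li}_{\mathbf{k}}^{\star}(1-e^{-t})}{1-e^{-t}}=\sum_{n=0}^\infty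 B_{n,\star}^{(\mathbf{k})}\frac{t^n}{n!},\qquad \frac{\operatorname{Li}_{\mathbf{k}}^{\star}(1-e^{-t})}{e^t-1}=\sum_{n=0}^\infty C_{n,\star}^{(\mathbf{k})}\frac{t^n}{n!}.$$ For rational numbers $a,b$, the congruence $a\equiv b \bmod p^N$ means $p^{-N}(a-b)\in\mathbb{Z}_p$, where $\mathbb{Z}_p$ is the ring of $p$-adic integers (i.e. $a-b$ has $p$-adic valuation at least $N$). *)

(* Defs.v *)
From mathcomp Require Import all_boot all_order all_algebra.

Set Implicit Arguments.
Unset Strict Implicit.
Unset Printing Implicit Defensive.

Import Order.TTheory GRing.Theory Num.Theory.
Local Open Scope ring_scope.

(* A formal power series over the rationals is its sequence of coefficients:
   f : fps stands for the sum of the f n * t ^ n. *)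
Definition fps := nat -> rat.

Definition fps_mul (f g : fps) : fps :=
  fun n => \sum_(i < n.+1) f i * g (n - i)%N.

Definition fps_one : fps := fun n => (n == 0%N)%:R.

Definition fps_pow (f : fps) (j : nat) : fps := iter j (fps_mul f) fps_one.

(* f(g(t)), meaningful when g 0 = 0: then g ^ j has no term of degree < j, so
   only the j <= n contribute to the coefficient of t ^ n. *)
Definition fps_comp (f g : fps) : fps :=
  fun n => \sum_(j < n.+1) f j * fps_pow g j n.

Definition fps_shift (f : fps) : fps := fun n => f n.+1.

(* Long division by a series h with h 0 != 0: the first n coefficients of the
   quotient, from q n = (f n - \sum_(i < n) q i * h (n - i)) / h 0. *)
Fixpoint fps_quot_seq (f h : fps) (n : nat) : seq rat :=
  if n is n'.+1 then
    let q := fps_quot_seq f h n' in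
    rcons q ((f n' - \sum_(i < n') q`_i * h (n' - i)%N) / h 0%N)
  else [::].

(* f / g for g of order exactly 1 and f of order at least 1; both are divided
   by t before the long division (see fps_divK). *)
Definition fps_div (f g : fps) : fps :=
  fun n => (fps_quot_seq (fps_shift f) (fps_shift g) n.+1)`_n.

Definition one_sub_exp_neg : fps :=
  fun n => (n == 0%N)%:R - (-1) ^+ n / n`!%:R.

Definition exp_sub_one : fps := fun n => n`!%:R^-1 - (n == 0%N)%:R.

Definition egf (a : nat -> rat) : fps := fun n => a n / n`!%:R.

Definition wt (r : nat) (k : r.-tuple int) : int := \sum_(i < r) tnth k i.

Definition pos_index (r : nat) (k : r.-tuple int) : r.-tuple int :=
  [tuple Num.max (tnth k i) 0 | i < r].

(* Li*_k: the coefficient of t ^ M sums over 0 < m_1 <= ... <= m_r = M, so each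
   m_i lies in 'I_M.+1. *)
Definition Li_star (r : nat) (k : r.-tuple int) : fps := fun M =>
  \sum_(m : r.-tuple 'I_M.+1 |
          let s := [seq nat_of_ord x | x <- m] in
          [&& all (ltn 0%N) s, sorted leq s & last 0%N s == M])
    \prod_(i < r) ((tnth m i : nat)%:R ^ tnth k i)^-1.

Definition B_star (r : nat) (k : r.-tuple int) (n : nat) : rat :=
  n`!%:R * fps_div (fps_comp (Li_star k) one_sub_exp_neg) one_sub_exp_neg n.

Definition C_star (r : nat) (k : r.-tuple int) (n : nat) : rat :=
  n`!%:R * fps_div (fps_comp (Li_star k) one_sub_exp_neg) exp_sub_one n.

(* The p-adic valuation of a nonzero rational; the value at 0 is junk. *)
Definition padic_val (p : nat) (x : rat) : int :=
  (logn p `|numq x|)%:Z - (logn p `|denq x|)%:Z.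

(* x lies in the ring of p-adic integers *)
Definition padic_integer (p : nat) (x : rat) : bool :=
  (x == 0) || (0 <= padic_val p x).

Definition congr_padic (p N : nat) (a b : rat) : bool :=
  padic_integer p ((p%:R ^+ N)^-1 * (a - b)).

Lemma size_fps_quot_seq f h n : size (fps_quot_seq f h n) = n.
Proof. by elim: n => //= n IHn; rewrite size_rcons IHn. Qed.

Lemma nth_fps_quot_seq f h n i : (i < n)%N ->
  (fps_quot_seq f h n)`_i = (fps_quot_seq f h i.+1)`_i.
Proof.
elim: n => // n IHn; rewrite ltnS leq_eqVlt => /predU1P[-> //|lt_in].
by rewrite [LHS]/= nth_rcons size_fps_quot_seq lt_in IHn.
Qed.

Lemma fps_divK f g : f 0%N = 0 -> g 0%N = 0 -> g 1%N != 0 ->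
  fps_mul g (fps_div f g) =1 f.
Proof.
move=> f0 g0 g1 [|n]; first by rewrite /fps_mul big_ord1 g0 mul0r f0.
rewrite /fps_mul big_ord_recl g0 mul0r add0r.
rewrite (reindex_inj rev_ord_inj) big_ord_recr /=.
rewrite /bump /= !add1n !subSS subnn subn0 {2}/fps_div /=.
rewrite nth_rcons size_fps_quot_seq ltnn eqxx.
rewrite mulrC divfK // addrC -[RHS](subrK (\sum_(i < n)
  (fps_quot_seq (fps_shift f) (fps_shift g) n)`_i * fps_shift g (n - i)%N)).
congr (_ + _); apply: eq_bigr => i _.
rewrite mulrC nth_fps_quot_seq // add1n subSS subKn; last exact: ltnW.
by rewrite /fps_shift /fps_div.
Qed.

Lemma Li_star0 r (k : r.-tuple int) : (0 < r)%N -> Li_star k 0%N = 0.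
Proof.
move=> r_gt0; rewrite /Li_star big_pred0 // => m /=; apply/and3P => -[].
case: r r_gt0 k m => // r _ _ m; case/tupleP: m => x m /= /andP[].
by case: x => [[]].
Qed.

Lemma Li_star_comp0 r (k : r.-tuple int) : (0 < r)%N ->
  fps_comp (Li_star k) one_sub_exp_neg 0%N = 0.
Proof. by move=> r_gt0; rewrite /fps_comp big_ord1 Li_star0 ?mul0r. Qed.

Lemma egf_fact (f : fps) : egf (fun n => n`!%:R * f n) =1 f.
Proof. by move=> n; rewrite /egf mulrAC mulfV ?mul1r // pnatr_eq0 -lt0n fact_gt0. Qed.

Lemma eq_fps_mulr (f g h : fps) : g =1 h -> fps_mul f g =1 fps_mul f h.
Proof. by move=> eq_gh n; apply: eq_bigr => i _; rewrite eq_gh. Qed.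

Lemma B_star_egf r (k : r.-tuple int) : (0 < r)%N ->
  fps_mul one_sub_exp_neg (egf (B_star k))
    =1 fps_comp (Li_star k) one_sub_exp_neg.
Proof.
move=> r_gt0 n; rewrite (eq_fps_mulr _ (egf_fact _)) fps_divK //.
exact: Li_star_comp0.
Qed.

Lemma C_star_egf r (k : r.-tuple int) : (0 < r)%N ->
  fps_mul exp_sub_one (egf (C_star k))
    =1 fps_comp (Li_star k) one_sub_exp_neg.
Proof.
move=> r_gt0 n; rewrite (eq_fps_mulr _ (egf_fact _)) fps_divK //.
exact: Li_star_comp0.
Qed.

(* Main.v *)
(** Write D f (x) = f (x) - f (x + 1). Since exp (- x t) (1 - exp (- t)) ^ K is
   the K-th D-difference in x of exp (- x t), if L_M denotes the coefficients
   of Li*_k, then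
     B_n = \sum_M L_(M+1) (D^M f_n)(0),  C_n = \sum_M L_(M+1) (D^M f_n)(1)
   for f_n (x) = (- x) ^ n.  By Euler's theorem, f_m - f_n is, on each residue
   class c + p y, a polynomial in y with coefficients in p ^ N Z.  In the group
   ring of translations D ^ (p ^ 2) = 1 - E ^ (p ^ 2) modulo p, and translating
   x by p ^ 2, i.e. y by p, is the identity modulo p; hence every p ^ 2
   differences gain a factor p, and D^M (f_m - f_n) is divisible by
   p ^ (N + M %/ p ^ 2).  This absorbs the denominator of L_(M+1), which is at
   most p ^ (l w) with p ^ l <= M + 1 and w = wt (k^+): for l > 2,
   M %/ p ^ 2 >= p ^ (l - 2) - 1 >= (l - 2) (p - 1) >= (l - 2) w. *)

Require Import Defs.
From mathcomp Require Import all_boot all_order all_algebra.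
From mathcomp Require Import cyclic ring zify.

Set Implicit Arguments.
Unset Strict Implicit.
Unset Printing Implicit Defensive.

Import Order.TTheory GRing.Theory Num.Theory.
Local Open Scope ring_scope.

(** * Iterated differences *)

Definition bdiff (V : zmodType) (f : nat -> V) (x : nat) : V := f x - f x.+1.

Lemma iter_bdiffE (R : comNzRingType) K (f : nat -> R) x :
  iter K (@bdiff R) f x =
    \sum_(j < K.+1) (-1) ^+ j * 'C(K, j)%:R * f (x + j)%N.
Proof.
elim: K x => [|K IHK] x; first by rewrite big_ord1 bin0 addn0 !mul1r.
rewrite iterS /bdiff !IHK [RHS]big_ord_recl /= !bin0 addn0.
rewrite [X in _ = _ + X](eq_bigr (fun i : 'I_K.+1 =>
    (-1) ^+ i.+1 * 'C(K, i.+1)%:R * f (x + i.+1)%N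
    - (-1) ^+ i * 'C(K, i)%:R * f (x.+1 + i)%N)) => [|i _]; last first.
  by rewrite /bump !add1n binS natrD exprS addSnnS; ring.
rewrite sumrB addrA; congr (_ - _).
rewrite [in RHS]big_ord_recr /= bin_small // mulr0 mul0r addr0.
by rewrite big_ord_recl bin0 addn0; congr (_ + _); apply: eq_bigr => i _; rewrite lift0.
Qed.

Lemma iter_bdiffB (V : zmodType) K (f g : nat -> V) x :
  iter K (@bdiff V) (fun j => f j - g j) x =
    iter K (@bdiff V) f x - iter K (@bdiff V) g x.
Proof.
elim: K x => //= K IHK x; rewrite /bdiff !IHK !opprB addrACA [RHS]addrACA.
by congr (_ + _); apply: addrC.
Qed.

(** * Divisibility by powers of p, polynomially on residue classes *)

(** Divisibility of the values alone would not improve under differences; with a polynomial [h], the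
    values at [y + p] and [y] agree modulo p, which gains a factor p. *)
Definition locally_poly_dvd (p s : nat) (f : nat -> int) : Prop :=
  forall c, exists h : {poly int},
    forall y : nat, f (c + p * y)%N = (p ^ s)%:R * h.[y%:R].

Lemma locally_poly_dvdD p s f g :
  locally_poly_dvd p s f -> locally_poly_dvd p s g ->
  locally_poly_dvd p s (fun x => f x + g x).
Proof.
move=> Af Ag c; have [h Eh] := Af c; have [h' Eh'] := Ag c.
by exists (h + h') => y; rewrite Eh Eh' hornerD mulrDr.
Qed.

Lemma locally_poly_dvdM p s f a : locally_poly_dvd p s f ->
  locally_poly_dvd p s (fun x => a * f x).
Proof.
move=> Af c; have [h Eh] := Af c.
by exists (a *: h) => y; rewrite Eh hornerZ mulrCA.
Qed.

Lemma locally_poly_dvdMp p s f : locally_poly_dvd p s f ->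
  locally_poly_dvd p s.+1 (fun x => p%:R * f x).
Proof.
move=> Af c; have [h Eh] := Af c.
by exists h => y; rewrite Eh mulrA -natrM -expnS.
Qed.

Lemma locally_poly_dvd_shift p s f j : locally_poly_dvd p s f ->
  locally_poly_dvd p s (fun x => f (x + j)%N).
Proof.
move=> Af c; have [h Eh] := Af (c + j)%N.
by exists h => y; rewrite -Eh addnAC.
Qed.

Lemma locally_poly_dvd_sum (I : Type) (r : seq I) p s (F : I -> nat -> int) :
  (forall i, locally_poly_dvd p s (F i)) ->
  locally_poly_dvd p s (fun x => \sum_(i <- r) F i x).
Proof.
move=> AF; elim: r => [|i r IHr].
  by move=> c; exists 0 => y; rewrite big_nil horner0 mulr0.
move=> c; have [h Eh] := locally_poly_dvdD (AF i) IHr c.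
by exists h => y; rewrite big_cons Eh.
Qed.

Lemma eq_locally_poly_dvd p s f g : f =1 g ->
  locally_poly_dvd p s f -> locally_poly_dvd p s g.
Proof.
by move=> efg Af c; have [h Eh] := Af c; exists h => y; rewrite -efg Eh.
Qed.

Lemma locally_poly_dvd_bdiff p s f : locally_poly_dvd p s f ->
  locally_poly_dvd p s (@bdiff int f).
Proof.
move=> Af; have A1 := locally_poly_dvdM (-1) (locally_poly_dvd_shift 1 Af).
apply: eq_locally_poly_dvd (locally_poly_dvdD Af A1) => x.
by rewrite /bdiff addn1 mulN1r.
Qed.

Lemma locally_poly_dvd_periodic p s f : locally_poly_dvd p s f ->
  locally_poly_dvd p s.+1 (fun x => f (x + p ^ 2)%N - f x).
Proof.
move=> Af c; have [h Eh] := Af c.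
have [g Eg]: exists g : {poly int}, h \Po ('X + p%:R) - h = p%:R * g.
  (* Horner induction: if the substitution adds [p%:R * g] to [h], it adds
     [p%:R * (g * ('X + p%:R) + h)] to [h * 'X + a%:P]. *)
  elim/poly_ind: h {Eh} => [|h a [g Eg]].
    by exists 0; rewrite comp_poly0 mulr0 subr0.
  exists (g * ('X + p%:R) + h).
  rewrite comp_polyD comp_polyM comp_polyX comp_polyC.
  have -> : h \Po ('X + p%:R) = h + p%:R * g by rewrite -Eg; ring.
  by ring.
exists g => y.
rewrite -addnA -mulnn -mulnDr !Eh -mulrBr expnSr natrM -mulrA; congr (_ * _).
have := congr1 (fun q => q.[y%:R]) Eg; rewrite !hornerE horner_comp !hornerE.
by rewrite natrD -!(rmorph_nat (@polyC int)) !hornerE.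
Qed.

(* Modulo p, (1 - E)^(p^2) = 1 - E^(p^2) for the shift E. *)
Lemma locally_poly_dvd_bdiff_p2 p s f : prime p -> odd p ->
  locally_poly_dvd p s f -> locally_poly_dvd p s.+1 (iter (p ^ 2) (@bdiff int) f).
Proof.
move=> p_pr p_odd Af.
have [q Eq]: exists q, (p ^ 2 = q.+1)%N.
  by exists (p ^ 2).-1; rewrite prednK // expn_gt0 prime_gt0.
(* Signed quotients by p of the binomial coefficients strictly between the two ends. *)
pose a j : int := (-1) ^+ j * ('C(p ^ 2, j) %/ p)%:R.
have A1 := locally_poly_dvdMp (locally_poly_dvd_sum (index_enum 'I_q)
  (fun i : 'I_q =>
     locally_poly_dvdM (a i.+1) (locally_poly_dvd_shift i.+1 Af))).
have A2 := locally_poly_dvdM (-1) (locally_poly_dvd_periodic Af).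
apply: eq_locally_poly_dvd (locally_poly_dvdD A2 A1) => x.
rewrite Eq iter_bdiffE big_ord_recl big_ord_recr /=.
rewrite /bump !add1n bin0 binn addn0 !mul1r mulN1r opprB.
(* As [p ^ 2] is odd, the last term has sign -1, and the two end terms form
   [f x - f (x + p ^ 2)]. *)
rewrite -signr_odd -Eq oddX p_odd orbT /= expr1 mulr1 mulN1r.
rewrite addrAC -addrA; congr (_ + _); congr (_ - _).
rewrite mulr_sumr; apply: eq_bigr => i _; rewrite add1n /a.
have p_dv : (p %| 'C(p ^ 2, i.+1))%N.
  have lt_i : (i.+1 < p ^ 2)%N by rewrite Eq ltnS.
  (* [i.+1 * 'C(p ^ 2, i.+1)] is a multiple of [p ^ 2], while [i.+1 < p ^ 2] carries at most one
     factor p. *)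
  have := mul_bin_diag (p ^ 2) i => E.
  rewrite -[p in (p %| _)%N]expn1.
  have : (p ^ 2 %| i.+1 * 'C(p ^ 2, i.+1))%N by rewrite -E dvdn_mulr.
  rewrite !pfactor_dvdn ?muln_gt0 ?bin_gt0 ?(ltnW lt_i) //.
  rewrite lognM ?bin_gt0 ?(ltnW lt_i) //.
  suff: (logn p i.+1 < 2)%N by lia.
  rewrite -(ltn_exp2l _ _ (prime_gt1 p_pr)) (leq_ltn_trans _ lt_i) //.
  by rewrite dvdn_leq // pfactor_dvdnn.
by rewrite -{2}(divnK p_dv) natrM; ring.
Qed.

(** Each block of [p ^ 2] differences raises the exponent by one; the [K %% p ^ 2] remaining ones
    preserve it. *)
Lemma iter_bdiff_dvd p s f K : prime p -> odd p -> locally_poly_dvd p s f ->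
  locally_poly_dvd p (s + K %/ p ^ 2) (iter K (@bdiff int) f).
Proof.
move=> p_pr p_odd Af; rewrite {2}(divn_eq K (p ^ 2)) [X in iter X]addnC iterD.
elim: (K %% p ^ 2)%N => [|j IHj] /=; last exact: locally_poly_dvd_bdiff.
elim: (K %/ p ^ 2)%N => [|q IHq]; first by rewrite addn0.
by rewrite mulSn iterD addnS; apply: locally_poly_dvd_bdiff_p2.
Qed.

(** * Powers modulo [p ^ N], by Euler's theorem *)

Lemma exprM_1mod (R : comNzRingType) (p e : nat) (v h : R) :
  v = 1 + p%:R * h -> exists h', v ^+ e = 1 + p%:R * h'.
Proof.
move=> Ev; have := subrX1 v e; set S := \sum_(i < e) _ => E.
exists (h * S); apply/eqP; rewrite addrC -subr_eq; apply/eqP.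
by rewrite E Ev; ring.
Qed.

(** Each p-th power gains a factor p: in [x ^+ p - 1 = (x - 1) * S], the factor [S] is a sum of p
    powers of [x], all 1 modulo p. *)
Lemma exprXp_1mod (R : comNzRingType) (p i : nat) (v h : R) :
  v = 1 + p%:R * h -> exists h', v ^+ (p ^ i) = 1 + (p ^ i.+1)%:R * h'.
Proof.
move=> Ev; elim: i => [|i [g Eg]]; first by exists h; rewrite !expn1 expr1.
rewrite expnSr exprM; set x := v ^+ _ in Eg *.
have Ex : x = 1 + p%:R * ((p ^ i)%:R * g) by rewrite Eg expnS natrM mulrA.
have sumE q : exists S, \sum_(j < q) x ^+ j = q%:R + p%:R * S.
  elim: q => [|q [S ES]]; first by exists 0; rewrite big_ord0 mulr0 addr0.
  have [g' Eg'] := exprM_1mod q Ex.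
  by exists (S + g'); rewrite big_ord_recr /= ES Eg' -natr1; ring.
have [S ES] := sumE p.
exists (g * (1 + S)); apply/eqP; rewrite addrC -subr_eq subrX1 ES Eg !expnS !natrM.
by apply/eqP; ring.
Qed.

(** If p divides [c], it divides [u], and both exponents are at least [N]. Otherwise [u ^+ (p - 1)]
    is 1 modulo p by Euler, and raising to [p ^ (N - 1)] makes it 1 modulo [p ^ N]. The general ring
    allows a polynomial [u]. *)
Lemma exprB_dvd (R : comNzRingType) (p N m n c : nat) (u h : R) :
  prime p -> (0 < N)%N -> (N <= m)%N -> (m <= n)%N ->
  (m = n %[mod (p - 1) * p ^ (N - 1)])%N -> u = c%:R + p%:R * h ->
  exists q, u ^+ m - u ^+ n = (p ^ N)%:R * q.
Proof.
move=> p_pr N_gt0 le_Nm le_mn /eqP eq_mn Eu.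
have [/dvdnP[c' Ec]|c_p] := boolP (p %| c)%N.
  have [v Ev]: exists v, u = p%:R * v.
    by exists (c'%:R + h); rewrite Eu Ec natrM; ring.
  exists (p%:R ^+ (m - N) * v ^+ m - p%:R ^+ (n - N) * v ^+ n).
  rewrite mulrBr natrX !mulrA -!exprD !subnKC ?(leq_trans le_Nm) //.
  by rewrite Ev !exprMn.
have [e Ee]: exists e, n = (m + (p - 1) * p ^ (N - 1) * e)%N.
  move: eq_mn; rewrite eq_sym eqn_mod_dvd // => /dvdnP[e Ee].
  by exists e; rewrite mulnC -Ee subnKC.
have [h1 Eh1]: exists h1, u ^+ (p - 1) = 1 + p%:R * h1.
  have /eqP: (c ^ (p - 1) = 1 %[mod p])%N.
    rewrite subn1 -totient_prime //; apply: Euler_exp_totient.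
    by rewrite coprime_sym prime_coprime.
  have c_gt0 : (0 < c ^ (p - 1))%N.
    by rewrite expn_gt0; case: (c) c_p => //; rewrite dvdn0.
  rewrite eqn_mod_dvd // => /dvdnP[b Eb].
  have Ec : (c%:R : R) ^+ (p - 1) = 1 + p%:R * b%:R.
    rewrite -natrX -(subnK c_gt0).
    by rewrite Eb natrD natrM; ring.
  have := subrXX u c%:R (p - 1); set S := \sum_(i < _) _ => ES.
  exists (b%:R + h * S); apply/eqP.
  rewrite -[_ ^+ _](subrK (c%:R ^+ (p - 1))) ES Ec Eu; apply/eqP; ring.
have [h2 Eh2] := exprXp_1mod (N - 1) Eh1.
rewrite -subSn // subSS subn0 in Eh2.
have [h3 Eh3] : exists h3, u ^+ ((p - 1) * p ^ (N - 1) * e) = 1 + (p ^ N)%:R * h3.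
  by rewrite !exprM; apply: exprM_1mod Eh2.
by exists (- (u ^+ m * h3)); rewrite Ee exprD Eh3; ring.
Qed.

Lemma locally_poly_dvd_expB p N m n :
  prime p -> (0 < N)%N -> (N <= m)%N -> (m <= n)%N ->
  (m = n %[mod (p - 1) * p ^ (N - 1)])%N ->
  locally_poly_dvd p N (fun j => (- j%:R) ^+ m - (- j%:R) ^+ n).
Proof.
move=> p_pr N_gt0 le_Nm le_mn eq_mn c.
pose u : {poly int} := - (c%:R + p%:R * 'X).
(* [c * (p - 1)] is a natural number congruent to [- c] modulo p. *)
have Eu : u = (c * (p - 1))%:R + p%:R * (- c%:R - 'X).
  by rewrite /u natrM natrB ?prime_gt0 //; ring.
have [q Eq] := exprB_dvd p_pr N_gt0 le_Nm le_mn eq_mn Eu.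
exists q => y; have := congr1 (fun q => q.[y%:R]) Eq.
rewrite /u -!(rmorph_nat (@polyC int)) !hornerE /= => <-.
by rewrite natrD natrM.
Qed.

(** * Power series: differences of exponentials and division *)

Lemma fps_mulBr (f g h : fps) n :
  fps_mul f (fun i => g i - h i) n = fps_mul f g n - fps_mul f h n.
Proof. by rewrite /fps_mul -sumrB; apply: eq_bigr => i _; rewrite mulrBr. Qed.

Lemma fps_mulBl (f g h : fps) n :
  fps_mul (fun i => f i - g i) h n = fps_mul f h n - fps_mul g h n.
Proof. by rewrite /fps_mul -sumrB; apply: eq_bigr => i _; rewrite mulrBl. Qed.

Lemma fps_mul1l (f : fps) : fps_mul fps_one f =1 f.
Proof.
move=> n; rewrite /fps_mul big_ord_recl mul1r subn0 big1 ?addr0 // => i _.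
by rewrite mul0r.
Qed.

(** Coefficient [n.+1] of the product is [g 1 * a n] plus terms in earlier [a i], so strong
    induction applies. *)
Lemma fps_mulrI (g a b : fps) : g 0%N = 0 -> g 1%N != 0 ->
  fps_mul g a =1 fps_mul g b -> a =1 b.
Proof.
move=> g0 g1 eq_ab; elim/ltn_ind=> n IHn.
have := eq_ab n.+1; rewrite /fps_mul.
do 2!rewrite big_ord_recl g0 mul0r add0r big_ord_recl /=.
rewrite /bump /= !add1n !subSS !subn0 => /eqP; rewrite -subr_eq0 opprD addrACA.
rewrite -sumrB big1 ?addr0 => [|i _]; last first.
  by rewrite -mulrBr IHn ?subrr ?mulr0 // !add1n subSS; have := ltn_ord i; lia.
by rewrite -mulrBr mulf_eq0 (negPf g1) subr_eq0 => /eqP.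
Qed.

Definition fps_exp (a : rat) : fps := fun n => a ^+ n / n`!%:R.

Lemma fps_mul_exp a b : fps_mul (fps_exp a) (fps_exp b) =1 fps_exp (a + b).
Proof.
move=> n; rewrite /fps_mul /fps_exp addrC exprDn mulr_suml.
apply: eq_bigr => i _; have le_in : (i <= n)%N by rewrite -ltnS.
have fact_neq0 j : (j`!%:R : rat) != 0 by rewrite pnatr_eq0 -lt0n fact_gt0.
rewrite -[X in _ = X / _]mulr_natr -(bin_fact le_in) !natrM.
have : ('C(n, i)%:R : rat) != 0 by rewrite pnatr_eq0 -lt0n bin_gt0.
have := fact_neq0 i; have := fact_neq0 (n - i)%N.
move: (i`!%:R : rat) ((n - i)`!%:R : rat) ('C(n, i)%:R : rat) => u v w v0 u0 w0.
by field; rewrite u0 v0 w0.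
Qed.

(* The coefficients of exp(- x t) (1 - exp(- t))^K. *)
Definition exp_bdiff (K x : nat) : fps :=
  fun n => iter K (@bdiff rat) (fun j => fps_exp (- j%:R) n) x.

Lemma fps_mul_expN1 K x :
  fps_mul (fps_exp (-1)) (exp_bdiff K x) =1 exp_bdiff K x.+1.
Proof.
elim: K x => [|K IHK] x n.
  by rewrite fps_mul_exp /exp_bdiff /= -natr1 opprD addrC.
by rewrite fps_mulBr !IHK.
Qed.

Lemma fps_mul_exp1 K x :
  fps_mul (fps_exp 1) (exp_bdiff K x.+1) =1 exp_bdiff K x.
Proof.
elim: K x => [|K IHK] x n.
  by rewrite fps_mul_exp /exp_bdiff /= -natr1 opprD addrC addrNK.
by rewrite fps_mulBr !IHK.
Qed.

Lemma fps_mul_one_sub_exp_neg K x :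
  fps_mul one_sub_exp_neg (exp_bdiff K x) =1 exp_bdiff K.+1 x.
Proof.
move=> n; rewrite -[LHS]/(fps_mul (fun i => fps_one i - fps_exp (-1) i) _ n).
by rewrite fps_mulBl fps_mul1l fps_mul_expN1.
Qed.

(** Multiplication by exp(t) moves the base point from 1 to 0; this is why the C numbers use
    differences at 1. *)
Lemma fps_mul_exp_sub_one K :
  fps_mul exp_sub_one (exp_bdiff K 1) =1 exp_bdiff K.+1 0.
Proof.
move=> n; transitivity
    (fps_mul (fun i => fps_exp 1 i - fps_one i) (exp_bdiff K 1) n).
  by apply: eq_bigr => i _; rewrite /fps_exp expr1n mul1r.
by rewrite fps_mulBl fps_mul1l fps_mul_exp1.
Qed.

Lemma fps_pow_one_sub_exp_neg K : fps_pow one_sub_exp_neg K =1 exp_bdiff K 0.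
Proof.
elim: K => [|K IHK] n; last first.
  by rewrite -fps_mul_one_sub_exp_neg; apply: eq_fps_mulr.
rewrite /exp_bdiff /= /fps_exp /fps_pow /= /fps_one oppr0 expr0n.
by case: n => [|n]; rewrite ?mul0r // divr1.
Qed.

Lemma one_sub_exp_neg0 : one_sub_exp_neg 0%N = 0.
Proof. by rewrite /one_sub_exp_neg expr0 divr1 subrr. Qed.

Lemma exp_bdiff_small K x n : (n < K)%N -> exp_bdiff K x n = 0.
Proof.
elim: K n => // K IHK n; rewrite ltnS => le_nK.
rewrite -fps_mul_one_sub_exp_neg /fps_mul big_ord_recl one_sub_exp_neg0 mul0r.
rewrite add0r big1 // => -[i lt_in] _; rewrite IHK ?mulr0 //= /bump.
by lia.
Qed.

(** By the hypothesis on [h], [exp_bdiff K x] is the quotient of (1 - exp(- t)) ^ (K + 1) by [h], so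
    the division is done term by term. The free bound [T] lets different [n] share one range of
    summation. *)
Lemma fps_div_comp (L h : fps) x : L 0%N = 0 -> h 0%N = 0 -> h 1%N != 0 ->
  (forall K, fps_mul h (exp_bdiff K x) =1 exp_bdiff K.+1 0) ->
  forall n T, (n < T)%N -> fps_div (fps_comp L one_sub_exp_neg) h n =
    \sum_(M < T) L M.+1 * exp_bdiff M x n.
Proof.
move=> L0 h0 h1 hE n T lt_nT.
pose b : fps := fun n => \sum_(M < n.+1) L M.+1 * exp_bdiff M x n.
have bE n' T' : (n' < T')%N -> b n' = \sum_(M < T') L M.+1 * exp_bdiff M x n'.
  move=> lt_nT'; rewrite /b (big_ord_widen T' (fun M => L M.+1 * exp_bdiff M x n')) //.
  rewrite big_mkcond; apply: eq_bigr => M _; case: ltnP => // lt_nM.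
  by rewrite exp_bdiff_small ?mulr0.
rewrite -bE //; move: n {lt_nT}; apply: (fps_mulrI h0 h1) => n.
rewrite fps_divK //; last by rewrite /fps_comp big_ord1 L0 mul0r.
rewrite /fps_comp big_ord_recl L0 mul0r add0r /fps_mul.
transitivity (\sum_(i < n.+1) \sum_(M < n.+1)
    L M.+1 * (h i * exp_bdiff M x (n - i)%N)); last first.
  apply: eq_bigr => i _; rewrite (bE _ n.+1) ?ltnS ?leq_subr // mulr_sumr.
  by apply: eq_bigr => M _; rewrite mulrCA.
rewrite exchange_big big_ord_recr /= -mulr_sumr.
rewrite -[X in _ + _ * X]/(fps_mul h (exp_bdiff n x) n).
(* The quotient has one more term, [M = n], than the composition, but its product with [h] has order
   above [n]. *)
rewrite hE exp_bdiff_small // mulr0 addr0; apply: eq_bigr => M _.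
rewrite -[fps_mul _ _]/(fps_pow one_sub_exp_neg M.+1) fps_pow_one_sub_exp_neg.
by rewrite -hE -mulr_sumr.
Qed.

Lemma iter_bdiffMr (R : pzRingType) K (f : nat -> R) a x :
  iter K (@bdiff R) (fun j => f j * a) x = iter K (@bdiff R) f x * a.
Proof. by elim: K x => //= K IHK x; rewrite /bdiff !IHK mulrBl. Qed.

Lemma iter_bdiff_intr (R : pzRingType) K (f : nat -> int) x :
  iter K (@bdiff R) (fun j => (f j)%:~R) x = (iter K (@bdiff int) f x)%:~R.
Proof. by elim: K x => //= K IHK x; rewrite /bdiff !IHK rmorphB. Qed.

(** Clearing the factorial turns coefficients into differences of an integer function, to which
    [iter_bdiff_dvd] applies. *)
Lemma exp_bdiff_intr K x n : n`!%:R * exp_bdiff K x n =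
  (iter K (@bdiff int) (fun j => (- j%:R) ^+ n) x)%:~R.
Proof.
rewrite /exp_bdiff /fps_exp iter_bdiffMr mulrC divfK; last first.
  by rewrite pnatr_eq0 -lt0n fact_gt0.
rewrite -iter_bdiff_intr; elim: K x => /= [|K IHK] x; last by rewrite /bdiff !IHK.
by rewrite rmorphXn rmorphN rmorph_nat.
Qed.

(** * p-integral rationals *)

(** The fraction need not be reduced, which makes closure under sums and products immediate. *)
Definition p_integral (p : nat) (x : rat) : Prop :=
  exists (d : nat) (z : int), ~~ (p %| d)%N /\ d%:R * x = z%:~R.

Lemma p_integral_padic p x : prime p -> p_integral p x -> padic_integer p x.
Proof.
move=> p_pr [d [z [p_d Ex]]]; rewrite /padic_integer.
case: eqP => //= /eqP x_neq0; rewrite /padic_val.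
suff /negPf p_den : ~~ (p %| `|denq x|)%N.
  by rewrite [logn p `|denq x|]lognE p_den !andbF subr0.
apply/negP => p_den.
(* If p divided the denominator, this identity would force it to divide the numerator too. *)
have E : d%:Z * numq x = z * denq x.
  apply: (@intr_inj rat); rewrite !rmorphM /= -Ex -mulrA -numqE //.
have : (p %| d * `|numq x|)%N.
  by have := congr1 absz E; rewrite !abszM /= => ->; rewrite dvdn_mull.
rewrite Euclid_dvdM // (negPf p_d) /= => p_num.
have := coprime_num_den x; rewrite /coprime => /eqP gcd1.
have : (p %| gcdn `|numq x| `|denq x|)%N by rewrite dvdn_gcd p_num p_den.
by rewrite gcd1 dvdn1 => /eqP p1; rewrite p1 in p_pr.
Qed.

Lemma p_integral_int p (z : int) : prime p -> p_integral p z%:~R.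
Proof.
by move=> p_pr; exists 1%N, z; rewrite dvdn1 mul1r neq_ltn prime_gt1 ?orbT.
Qed.

Lemma p_integralD p x y : prime p ->
  p_integral p x -> p_integral p y -> p_integral p (x + y).
Proof.
move=> p_pr [d [z [p_d Ex]]] [d' [z' [p_d' Ey]]].
exists (d * d')%N, (d'%:Z * z + d%:Z * z').
rewrite Euclid_dvdM // negb_or p_d p_d'; split=> //.
by rewrite natrM rmorphD !rmorphM /= -Ex -Ey; ring.
Qed.

Lemma p_integralM p x y : prime p ->
  p_integral p x -> p_integral p y -> p_integral p (x * y).
Proof.
move=> p_pr [d [z [p_d Ex]]] [d' [z' [p_d' Ey]]].
exists (d * d')%N, (z * z').
rewrite Euclid_dvdM // negb_or p_d p_d'; split=> //.
by rewrite natrM rmorphM /= -Ex -Ey; ring.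
Qed.

Lemma p_integral_sum (I : Type) (r : seq I) (P : pred I) (F : I -> rat) p :
  prime p -> (forall i, P i -> p_integral p (F i)) ->
  p_integral p (\sum_(i <- r | P i) F i).
Proof.
move=> p_pr PF; apply: (big_ind (p_integral p)) => //.
  exact: (p_integral_int 0).
by move=> x y; apply: p_integralD.
Qed.

Lemma p_integral_prod (I : Type) (r : seq I) (P : pred I) (F : I -> rat) p :
  prime p -> (forall i, P i -> p_integral p (F i)) ->
  p_integral p (\prod_(i <- r | P i) F i).
Proof.
move=> p_pr PF; apply: (big_ind (p_integral p)) => //.
  exact: (p_integral_int 1).
by move=> x y; apply: p_integralM.
Qed.

Lemma p_integralX p x n : prime p -> p_integral p x -> p_integral p (x ^+ n).
Proof.
move=> p_pr px; elim: n => [|n IHn]; first exact: (p_integral_int 1).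
by rewrite exprS; apply: p_integralM.
Qed.

Lemma p_integral_expp_div p l m : prime p -> (0 < m)%N -> (logn p m <= l)%N ->
  p_integral p ((p ^ l)%:R / m%:R).
Proof.
move=> p_pr m_gt0 le_vl.
have [m' p_m' Em] := pfactor_coprime p_pr m_gt0.
have m'_neq0 : (m'%:R : rat) != 0.
  by rewrite pnatr_eq0; apply: contraTneq m_gt0 => m0; rewrite Em m0.
have p_neq0 : (p%:R : rat) != 0 by rewrite pnatr_eq0 -lt0n prime_gt0.
exists m', (p ^ (l - logn p m))%N%:Z; rewrite -prime_coprime // p_m'; split=> //.
rewrite {1}Em -{1}(subnK le_vl) expnD !natrM -[RHS]/((p ^ _)%N%:R).
have : ((p ^ logn p m)%:R : rat) != 0 by rewrite natrX expf_neq0.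
by move: ((p ^ logn p m)%:R : rat) => v v0; field; rewrite v0 m'_neq0.
Qed.

(** A negative exponent puts [m] in the numerator and costs nothing, hence the positive part of
    [k]. *)
Lemma p_integral_expzV p l m (k : int) : prime p -> (0 < m)%N ->
  (logn p m <= l)%N ->
  p_integral p ((p ^ (l * `|Num.max k 0|))%:R * (m%:R ^ k)^-1).
Proof.
move=> p_pr m_gt0 le_vl; case: k => k.
  rewrite max_l // absz_nat expnM natrX -exprVn -exprMn.
  by apply: p_integralX => //; apply: p_integral_expp_div.
rewrite max_r // muln0 expn0 mul1r NegzE -exprnN invrK.
by apply: p_integralX => //; apply: (p_integral_int m).
Qed.

(** * Denominators of the coefficients of Li* *)

Definition pos_wt (r : nat) (k : r.-tuple int) : nat :=
  \sum_(i < r) `|Num.max (tnth k i) 0|%N.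

Lemma wt_pos_index r (k : r.-tuple int) : wt (pos_index k) = (pos_wt k)%:Z.
Proof.
rewrite /wt /pos_wt; apply: (big_ind2 (fun (x : int) y => x = y%:Z)) => //.
  by move=> x1 x2 y1 y2 -> ->.
move=> i _; rewrite tnth_mktuple.
by rewrite gez0_abs // le_max lexx orbT.
Qed.

(** Every [m_i] is at most [M], so its p-part is at most [p ^ trunc_log p M]; the exponents add up
    over the factors. *)
Lemma p_integral_Li_star p r (k : r.-tuple int) M : prime p ->
  p_integral p ((p ^ (trunc_log p M * pos_wt k))%:R * Li_star k M).
Proof.
move=> p_pr; rewrite /Li_star mulr_sumr; apply: p_integral_sum => // m /and3P[m_gt0 _ _].
rewrite /pos_wt big_distrr /= expn_sum natr_prod -big_split /=.
apply: p_integral_prod => // i _.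
have mi_gt0 : (0 < tnth m i)%N.
  by move/allP: m_gt0; apply; apply: map_f; apply: mem_tnth.
apply: p_integral_expzV => //; apply: trunc_log_max; first exact: prime_gt1.
by rewrite (leq_trans (dvdn_leq mi_gt0 (pfactor_dvdnn _ _))) // -ltnS.
Qed.

(** Bernoulli's inequality for [p = 1 + (p - 1)]. *)
Lemma ltn_mul_expn p l : (1 < p)%N -> (l * (p - 1) < p ^ l)%N.
Proof.
move=> p_gt1; elim: l => [|l IHl]; first by rewrite mul0n.
by rewrite expnS; nia.
Qed.

Lemma trunc_log_mul_le p w M : prime p -> (w < p - 1)%N ->
  (trunc_log p M.+1 * w <= 2 * w + M %/ p ^ 2)%N.
Proof.
move=> p_pr lt_wp; have p_gt1 := prime_gt1 p_pr.
(* A logarithm of at most 2 is covered by the factor [p ^ (2 * w)] alone. *)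
have [le_l2|] := leqP (trunc_log p M.+1) 2.
  by apply: leq_trans (leq_addr _ _); rewrite leq_mul2r le_l2 orbT.
have := trunc_logP p_gt1 (ltn0Sn M).
(* From here [l] is the logarithm minus 2, and [p ^ (l + 2) <= M.+1] gives
   [(p ^ l).-1 <= M %/ p ^ 2]. *)
case: (trunc_log p M.+1) => [|[|l]] //; rewrite -addn2 => le_plM _.
have p2_gt0 : (0 < p ^ 2)%N by rewrite expn_gt0 prime_gt0.
rewrite mulnDl addnC leq_add2l; apply: (@leq_trans (p ^ l).-1).
  have := ltn_mul_expn l p_gt1; nia.
rewrite leq_divRL // -ltnS (leq_trans _ le_plM) // expnD.
by rewrite ltn_mul2r p2_gt0 prednK ?leqnn // expn_gt0 (ltnW p_gt1).
Qed.

(** * The congruences *)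

Lemma congr_padic_sym p N a b : congr_padic p N a b -> congr_padic p N b a.
Proof.
rewrite /congr_padic -opprB mulrN /padic_integer oppr_eq0 /padic_val.
by rewrite numqN denqN abszN.
Qed.

(** Treats both families at once: they differ only in the divisor [h] and the base point [x]. *)
Lemma congr_padic_fps_div r (k : r.-tuple int) (p m n N x : nat) (h : fps)
    (S : nat -> rat) :
  (0 < r)%N -> prime p -> odd p -> (0 < N)%N -> (N <= m)%N -> (N <= n)%N ->
  (pos_wt k < p - 1)%N -> (m = n %[mod (p - 1) * p ^ (N - 1)])%N ->
  h 0%N = 0 -> h 1%N != 0 ->
  (forall K, fps_mul h (exp_bdiff K x) =1 exp_bdiff K.+1 0) ->
  (forall l, S l = l`!%:R * fps_div (fps_comp (Li_star k) one_sub_exp_neg) h l) ->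
  congr_padic p N (p%:R ^ (2 * wt (pos_index k)) * S m)
                  (p%:R ^ (2 * wt (pos_index k)) * S n).
Proof.
move=> r_gt0 p_pr p_odd N_gt0 le_Nm le_Nn lt_wp eq_mn h0 h1 hE defS.
wlog le_mn : m n le_Nm le_Nn eq_mn / (m <= n)%N.
  move=> H; have [|/ltnW] := leqP m n; first exact: H.
  by move=> le_nm; apply: congr_padic_sym; apply: H.
have SE l : (l <= n)%N -> S l = \sum_(M < n.+1) Li_star k M.+1 *
    (iter M (@bdiff int) (fun j => (- j%:R) ^+ l) x)%:~R.
  move=> le_ln; rewrite defS (fps_div_comp (Li_star0 _ _) h0 h1 hE (T := n.+1)) //.
  by rewrite mulr_sumr; apply: eq_bigr => M _; rewrite mulrCA exp_bdiff_intr.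
have p_neq0 : (p%:R : rat) != 0 by rewrite pnatr_eq0 -lt0n prime_gt0.
rewrite /congr_padic -mulrBr SE // SE // -sumrB wt_pos_index.
rewrite -[2%:Z * _]/((2 * pos_wt k)%N%:Z) -exprnP.
apply: p_integral_padic => //; rewrite !mulr_sumr; apply: p_integral_sum => // M _.
rewrite -mulrBr -rmorphB -iter_bdiffB.
have [g Eg] := iter_bdiff_dvd M p_pr p_odd
  (locally_poly_dvd_expB p_pr N_gt0 le_Nm le_mn eq_mn) x.
have := Eg 0%N; rewrite muln0 addn0 => ->; set z := g.[_].
have le_w := trunc_log_mul_le M p_pr lt_wp.
set l := trunc_log p M.+1 in le_w.
(* [p ^ N] cancels; of the remaining power of p, [p ^ (l * pos_wt k)] clears the denominator of the
   coefficient of Li*, and [le_w] makes the leftover exponent a true difference. *)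
have -> : (p%:R ^+ N)^-1 * (p%:R ^+ (2 * pos_wt k) * (Li_star k M.+1 *
      ((p ^ (N + M %/ p ^ 2))%:R * z)%:~R)) =
    (p ^ (2 * pos_wt k + M %/ p ^ 2 - l * pos_wt k))%:Z%:~R *
    ((p ^ (l * pos_wt k))%:R * Li_star k M.+1) * z%:~R :> rat.
  transitivity (p%:R ^+ (2 * pos_wt k + M %/ p ^ 2) * Li_star k M.+1 * z%:~R : rat).
    rewrite rmorphM /= rmorph_nat natrX !exprD.
    by field; rewrite expf_neq0.
  rewrite -{1}(subnK le_w) exprD.
  rewrite -[(_%:Z)%:~R]/((p ^ _)%N%:R) !natrX; ring.
apply: p_integralM => //; last exact: p_integral_int.
apply: p_integralM => //; first exact: p_integral_int.
exact: p_integral_Li_star.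
Qed.

Theorem theorem4p4 (r : nat) (k : r.-tuple int) (p m n N : nat)
  (r_gt0 : (1 <= r)%N) (p_prime : prime p) (p_odd : odd p)
  (m_gt0 : (0 < m)%N) (n_gt0 : (0 < n)%N) (N_gt0 : (0 < N)%N)
  (le_Nm : (N <= m)%N) (le_Nn : (N <= n)%N)
  (wt_lt : wt (pos_index k) < p%:Z - 1)
  (eq_mn : (m = n %[mod (p - 1) * p ^ (N - 1)])%N) :
  congr_padic p N (p%:R ^ (2 * wt (pos_index k)) * B_star k m)
                  (p%:R ^ (2 * wt (pos_index k)) * B_star k n)
  /\
  congr_padic p N (p%:R ^ (2 * wt (pos_index k)) * C_star k m)
                  (p%:R ^ (2 * wt (pos_index k)) * C_star k n).
Proof.
have lt_wp : (pos_wt k < p - 1)%N.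
  by have := prime_gt1 p_prime; move: wt_lt; rewrite wt_pos_index; lia.
split.
  apply: (congr_padic_fps_div (x := 0) (h := one_sub_exp_neg)) => //.
  by move=> K; apply: fps_mul_one_sub_exp_neg.
apply: (congr_padic_fps_div (x := 1) (h := exp_sub_one)) => //.
exact: fps_mul_exp_sub_one.
Qed.
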